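(* Let $X$ be an abelian group. (i) Let $(X,S^* )$ be a linear braided nondegenerate set, $S^*(x,y)=(ax+by,cx+dy)$ with $a,b,c,d\in\mathrm{End}(X)$, and let $z,t\in X$. Then $(X,S)$ given by $S(x,y)=(ax+by+z,\ cx+dy+t)$ is an affine solution associated with $(X,S^* )$ if and only if $t=-c(1-a)^{-1}z+k$ with $k\in X$ satisfying $ak=dk=0$ and $(b-1)k=sz$, where $s\in\mathrm{End}(X)$ is defined by $bc=(1-d+ad)(1-a)+s$. (ii) An affine solution $(X,S)$ is injective if and only if its linear part is injective and $k=0$ in the characterization of (i). In this way, injective affine solutions associated with a given injective linear solution $(X,S^* )$ are in 1-1 correspondence with elements $z\in X$, $t$ being given by $t=-c(1-a)^{-1}z$.
   Context: Let $X$ be a nonempty set and $S:X\times X\to X\times X$ a bijection, written $S(x,y)=(g_x(y),f_y(x))$. $(X,S)$ is a braided set if $S_1S_2S_1=S_2S_1S_2$ on $X^3$, where $S_1=S\times \mathrm{id}$, $S_2=\mathrm{id}\times S$; it is nondegenerate if all maps $g_x$ and $f_y$ are bijections of $X$. The structure group $G_X$ is the group generated by the elements of $X$ with relations $xy=y_1x_1$ whenever $S(x,y)=(y_1,x_1)$. A nondegenerate braided set is injective if the natural map $X\to G_X$ is injective. Let $X$ be an abelian group. A linear solution (linear braided nondegenerate set) is a nondegenerate braided set with $S(x,y)=(ax+by,cx+dy)$, $a,b,c,d\in\mathrm{End}(X)$; for such a set $1-a$ is invertible. An affine solution is a nondegenerate braided set $(X,S)$ of the form $S(x,y)=(ax+by+z,cx+dy+t)$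 with $a,b,c,d\in\mathrm{End}(X)$, $z,t\in X$. For an affine solution, $(X,S^* )$ with $S^*(x,y)=(ax+by,cx+dy)$ is a linear solution, called the linear part of $(X,S)$, and $(X,S)$ is called an affine solution associated with $(X,S^* )$. *)

(* Defs.v *)
From HB Require Import structures.
From mathcomp Require Import all_boot all_order all_algebra.
From mathcomp Require Import all_classical.

Set Implicit Arguments.
Unset Strict Implicit.
Unset Printing Implicit Defensive.

Import GRing.Theory.
Local Open Scope ring_scope.
Local Open Scope classical_set_scope.

Section BraidedSets.
Variables (X : Type) (S : X * X -> X * X).

(* [S (x, y) = (gmap x y, fmap y x)]: the subscript comes first. *)
Definition gmap (x y : X) : X := (S (x, y)).1.
Definition fmap (y x : X) : X := (S (x, y)).2.

Definition S12 (p : X * X * X) : X * X * X :=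
  let q := S (p.1.1, p.1.2) in (q.1, q.2, p.2).
Definition S23 (p : X * X * X) : X * X * X :=
  let q := S (p.1.2, p.2) in (p.1.1, q.1, q.2).

Definition braided_set : Prop :=
  [/\ inhabited X, bijective S & S12 \o S23 \o S12 =1 S23 \o S12 \o S23].

Definition nondegenerate : Prop :=
  (forall x, bijective (gmap x)) /\ (forall y, bijective (fmap y)).

Definition nondegenerate_braided_set : Prop := braided_set /\ nondegenerate.

End BraidedSets.

(* The structure group, as the quotient of the words in the letters
   [(false, x)], standing for [x], and [(true, x)], standing for [x^-1], by the
   congruence generated by free cancellation and the defining relations. *)
Section StructureGroup.
Variables (X : choiceType) (S : X * X -> X * X).

Local Notation word := (seq (bool * X)).

Inductive word_cong : word -> word -> Prop :=
| word_cong_refl u : word_cong u u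
| word_cong_sym u v : word_cong u v -> word_cong v u
| word_cong_trans u v w : word_cong u v -> word_cong v w -> word_cong u w
| word_cong_cancel u v e x :
    word_cong (u ++ [:: (e, x); (~~ e, x)] ++ v) (u ++ v)
| word_cong_rel u v x y x1 y1 : S (x, y) = (y1, x1) ->
    word_cong (u ++ [:: (false, x); (false, y)] ++ v)
              (u ++ [:: (false, y1); (false, x1)] ++ v).

Definition word_congb (u v : word) : bool := `[< word_cong u v >].

Lemma word_congb_equiv : equiv_class_of word_congb.
Proof.
split=> [u | u v | v u w].
- exact/asboolP/word_cong_refl.
- by apply/asboolP/asboolP; apply: word_cong_sym.
- by move=> /asboolP uv /asboolP vw; apply/asboolP/(word_cong_trans uv vw).
Qed.

Canonical word_congb_equiv_rel := EquivRelPack word_congb_equiv.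

Definition structure_group : Type := {eq_quot word_congb}%qT.
HB.instance Definition _ := Choice.on structure_group.

Definition word_class (u : word) : structure_group := (\pi_{eq_quot word_congb} u)%qT.
Definition word_repr (g : structure_group) : word :=
  repr (g : {eq_quot word_congb}%qT).

Lemma word_reprK : cancel word_repr word_class.
Proof. by move=> g; apply: reprK. Qed.

Lemma word_classP u v : word_class u = word_class v <-> word_cong u v.
Proof. by split=> [/eqmodP/asboolP | uv] //; apply/eqmodP/asboolP. Qed.

Definition word_inv (u : word) : word := rev [seq (~~ a.1, a.2) | a <- u].

Lemma word_cong_catl w u v : word_cong u v -> word_cong (w ++ u) (w ++ v).
Proof.
elim=> {u v} [u | u v _ | u v t _ uv _ | u v e x | u v x y x1 y1 E].
- exact: word_cong_refl.
- exact: word_cong_sym.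
- exact: word_cong_trans.
- by rewrite !catA -[X in word_cong X](catA (w ++ u)); apply: word_cong_cancel.
- by rewrite !(catA w); apply: word_cong_rel.
Qed.

Lemma word_cong_catr w u v : word_cong u v -> word_cong (u ++ w) (v ++ w).
Proof.
elim=> {u v} [u | u v _ | u v t _ uv _ | u v e x | u v x y x1 y1 E].
- exact: word_cong_refl.
- exact: word_cong_sym.
- exact: word_cong_trans.
- by rewrite -!catA; apply: word_cong_cancel.
- by rewrite -!catA; apply: word_cong_rel.
Qed.

Lemma word_cong_cat u u' v v' :
  word_cong u u' -> word_cong v v' -> word_cong (u ++ v) (u' ++ v').
Proof.
move=> uu' vv'; apply: word_cong_trans (word_cong_catr v uu') _.
exact: word_cong_catl.
Qed.

Lemma word_invK : involutive word_inv.
Proof.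
move=> u; rewrite /word_inv map_rev revK -map_comp.
by rewrite -[RHS]map_id; apply: eq_map => -[e x] /=; rewrite negbK.
Qed.

Lemma word_cong_mulV u : word_cong (u ++ word_inv u) [::].
Proof.
elim: u => [|[e x] u IHu]; first exact: word_cong_refl.
rewrite /word_inv map_cons rev_cons -cats1 -/(word_inv u) -cat1s -!catA.
apply: word_cong_trans (word_cong_cancel [::] [::] e x).
by rewrite /= -cat1s -[X in word_cong _ X]cat1s; apply: word_cong_catl;
  rewrite catA; apply: (word_cong_catr [:: (~~ e, x)] IHu).
Qed.

Lemma word_cong_inv u v : word_cong u v -> word_cong (word_inv u) (word_inv v).
Proof.
move=> uv; set u' := word_inv u; set v' := word_inv v.
have Vu : word_cong (u' ++ u) [::].
  by have := word_cong_mulV u'; rewrite {2}/u' word_invK.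
apply: (@word_cong_trans _ (u' ++ (v ++ v'))).
  by rewrite -{1}[u']cats0; apply/word_cong_catl/word_cong_sym/word_cong_mulV.
rewrite catA -[X in word_cong _ X]cat0s; apply: word_cong_catr.
apply: word_cong_trans Vu; apply: word_cong_catl; exact: word_cong_sym.
Qed.

Definition sg_one : structure_group := word_class [::].
Definition sg_mul (g h : structure_group) : structure_group :=
  word_class (word_repr g ++ word_repr h).
Definition sg_inv (g : structure_group) : structure_group :=
  word_class (word_inv (word_repr g)).

Lemma word_repr_class u : word_cong (word_repr (word_class u)) u.
Proof. by apply/word_classP; rewrite word_reprK. Qed.

Lemma sg_mulE u v :
  sg_mul (word_class u) (word_class v) = word_class (u ++ v).
Proof. by apply/word_classP/word_cong_cat; apply: word_repr_class. Qed.

Lemma sg_invE u : sg_inv (word_class u) = word_class (word_inv u).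
Proof. by apply/word_classP/word_cong_inv; apply: word_repr_class. Qed.

Lemma sg_mulA : associative sg_mul.
Proof.
move=> g h k; rewrite -(word_reprK g) -(word_reprK h) -(word_reprK k).
by rewrite !sg_mulE catA.
Qed.

Lemma sg_mul1g : left_id sg_one sg_mul.
Proof. by move=> g; rewrite -(word_reprK g) sg_mulE. Qed.

Lemma sg_mulg1 : right_id sg_one sg_mul.
Proof. by move=> g; rewrite -(word_reprK g) sg_mulE cats0. Qed.

Lemma sg_mulgV : right_inverse sg_one sg_inv sg_mul.
Proof.
move=> g; rewrite -(word_reprK g) sg_invE sg_mulE.
by apply/word_classP/word_cong_mulV.
Qed.

Lemma sg_mulVg : left_inverse sg_one sg_inv sg_mul.
Proof.
move=> g; rewrite -(word_reprK g) sg_invE sg_mulE; apply/word_classP.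
rewrite -{2}[word_repr g]word_invK; exact: word_cong_mulV.
Qed.

HB.instance Definition _ := isGroup.Build structure_group
  sg_mulA sg_mul1g sg_mulg1 sg_mulVg sg_mulgV.

Definition structure_gen (x : X) : structure_group := word_class [:: (false, x)].

Lemma structure_genP x y x1 y1 : S (x, y) = (y1, x1) ->
  (structure_gen x * structure_gen y = structure_gen y1 * structure_gen x1)%g.
Proof.
move=> E; apply: etrans (sg_mulE _ _) (etrans _ (esym (sg_mulE _ _))).
apply/word_classP; exact: (word_cong_rel [::] [::] E).
Qed.

Lemma structure_group_lift (H : groupType) (h : X -> H) :
  (forall x y x1 y1, S (x, y) = (y1, x1) -> (h x * h y = h y1 * h x1)%g) ->
  exists2 F : structure_group -> H,
    {morph F : g k / (g * k)%g} & forall x, F (structure_gen x) = h x.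
Proof.
move=> hS; pose l (a : bool * X) : H := if a.1 then (h a.2)^-1%g else h a.2.
pose ev (u : word) : H := foldr (fun a r => (l a * r)%g) 1%g u.
have evD u v : ev (u ++ v) = (ev u * ev v)%g.
  by elim: u => [|a u IHu] /=; rewrite ?mul1g // IHu mulgA.
have evP u v : word_cong u v -> ev u = ev v.
  elim=> {u v} [//|//|u v w _ -> _ -> //|u v e x|u v x y x1 y1 E].
    by rewrite !evD /= /l /=; case: e; rewrite /= mulg1 ?mulVg ?mulgV mul1g.
  by rewrite !evD /= /l /= !mulg1 (hS _ _ _ _ E).
exists (fun g => ev (word_repr g)) => [g k|x] /=.
  by rewrite -evD; exact/evP/word_repr_class.
by rewrite (evP _ _ (word_repr_class _)) /= mulg1.
Qed.

Definition injective_set : Prop := injective structure_gen.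

End StructureGroup.

Section AffineSolutions.
Variable X : zmodType.
Implicit Types (a b c d f : {additive X -> X}) (z t k : X).
Implicit Types (S Sl : X * X -> X * X).

Definition linear_map a b c d (p : X * X) : X * X :=
  (a p.1 + b p.2, c p.1 + d p.2).

Definition affine_map a b c d z t (p : X * X) : X * X :=
  (a p.1 + b p.2 + z, c p.1 + d p.2 + t).

Definition linear_solution S : Prop :=
  nondegenerate_braided_set S /\ exists a b c d, S = linear_map a b c d.

Definition affine_solution S : Prop :=
  nondegenerate_braided_set S /\
  exists a b c d z t, S = affine_map a b c d z t.

Definition linear_part_of S Sl : Prop :=
  exists a b c d z t, S = affine_map a b c d z t /\ Sl = linear_map a b c d.

Definition associated S Sl : Prop := affine_solution S /\ linear_part_of S Sl.

(* [1 - a], as an element of End(X). *)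
Definition one_sub a : {additive X -> X} := (idfun : {additive X -> X}) \- a.

(* The inverse of [f] (a junk value if [f] is not bijective). *)
Definition endo_inv f : X -> X := 'pinv_(fun=> 0) [set: X] f.

(* [s] is determined by [b c = (1 - d + a d)(1 - a) + s]. *)
Definition s_endo a b c d : {additive X -> X} :=
  (b \o c) \-
  (((idfun : {additive X -> X}) \- d \+ (a \o d)) \o one_sub a).

Definition affine_parameter a b c d z t k : Prop :=
  [/\ t = - c (endo_inv (one_sub a) z) + k, a k = 0, d k = 0
    & b k - k = s_endo a b c d z].

Lemma s_endoP a b c d x :
  let y := one_sub a x in
  b (c x) = (y - d y + a (d y)) + s_endo a b c d x.
Proof. by move=> y; rewrite /s_endo /= [RHS]addrC subrK. Qed.

Lemma linear_map_affine a b c d : linear_map a b c d = affine_map a b c d 0 0.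
Proof. by apply/funext => p; rewrite /affine_map !addr0. Qed.

Lemma affine_solution_bij a b c d z t :
  nondegenerate (affine_map a b c d z t) -> bijective b /\ bijective c.
Proof.
case=> /(_ 0) bg /(_ 0) bf; split.
- have -> : (b : X -> X) = (fun x => x - z) \o gmap (affine_map a b c d z t) 0.
    by apply/funext=> x; rewrite /gmap /= raddf0 add0r addrK.
  by apply: bij_comp bg; exists (fun x => x + z) => x; rewrite ?subrK ?addrK.
- have -> : (c : X -> X) = (fun x => x - t) \o fmap (affine_map a b c d z t) 0.
    by apply/funext=> x; rewrite /fmap /= raddf0 addr0 addrK.
  by apply: bij_comp bf; exists (fun x => x + t) => x; rewrite ?subrK ?addrK.
Qed.

Lemma S12_affine a b c d z t p :
  S12 (affine_map a b c d z t) p = S12 (linear_map a b c d) p + (z, t, 0).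
Proof. by case: p => [[x y] w]; congr (_, _, _); rewrite addr0. Qed.

Lemma S23_affine a b c d z t p :
  S23 (affine_map a b c d z t) p = S23 (linear_map a b c d) p + (0, z, t).
Proof. by case: p => [[x y] w]; congr (_, _, _); rewrite addr0. Qed.

Lemma S12_linearD a b c d :
  {morph S12 (linear_map a b c d) : p q / p + q}.
Proof.
by move=> [[x y] w] [[x' y'] w']; congr (_, _, _); rewrite /= !raddfD addrACA.
Qed.

Lemma S23_linearD a b c d :
  {morph S23 (linear_map a b c d) : p q / p + q}.
Proof.
by move=> [[x y] w] [[x' y'] w']; congr (_, _, _); rewrite /= !raddfD addrACA.
Qed.

Lemma S12_linear0 a b c d : S12 (linear_map a b c d) 0 = 0.
Proof. by congr (_, _, _); rewrite /= !raddf0 addr0. Qed.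

Lemma S23_linear0 a b c d : S23 (linear_map a b c d) 0 = 0.
Proof. by congr (_, _, _); rewrite /= !raddf0 addr0. Qed.

Lemma affine_solution_linear a b c d z t :
  affine_solution (affine_map a b c d z t) ->
  linear_solution (linear_map a b c d).
Proof.
move=> -[[[_ bS yb] nd] _]; split; last by exists a, b, c, d.
have [bb bc] := affine_solution_bij nd.
split; [split; first by exists; exact: 0|split].
- have -> : linear_map a b c d =
      (fun p => (p.1 - z, p.2 - t)) \o affine_map a b c d z t.
    by apply/funext=> p; rewrite /linear_map /= !addrK.
  apply: bij_comp bS; exists (fun p => (p.1 + z, p.2 + t)) => -[x y] /=;
    by rewrite ?subrK ?addrK.
- move=> p; have := yb 0; have := yb p.
  rewrite /= !(S12_affine, S23_affine, S12_linearD, S23_linearD).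
  rewrite !(S12_linear0, S23_linear0, add0r) -!addrA => + E; rewrite E.
  exact: addIr.
- move=> x; case: bb => b' bK Kb; exists (fun y => b' (y - a x)) => y;
    by rewrite /gmap /= ?Kb ?[a x + _]addrC ?addrK ?subrK ?bK.
- move=> y; case: bc => c' cK Kc; exists (fun x => c' (x - d y)) => x;
    by rewrite /fmap /= ?Kc ?addrK ?subrK ?cK.
Qed.

Lemma linear_solution_one_sub a b c d :
  linear_solution (linear_map a b c d) -> bijective (one_sub a).
Proof.
rewrite linear_map_affine => -[[[_ _ yb] nd] _].
have [[b' bK Kb] [c' cK Kc]] := affine_solution_bij nd.
have bac x : b (a (c x)) = a x - a (a x).
  have := congr1 (fun p => p.1.1) (yb (x, 0, 0)).
  rewrite /= !(raddf0, raddfD, addr0) => E.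
  by apply/esym/eqP; rewrite subr_eq addrC; apply/eqP/esym.
have ca x : a (c x) - d (a (c x)) = c (a x).
  have := congr1 (fun p => p.1.2) (yb (x, 0, 0)).
  rewrite /= !(raddf0, raddfD, addr0) => E.
  by rewrite -{1}E addrK.
have ab y : b (a y) - b (a (d y)) = a (b y).
  have := congr1 (fun p => p.1.1) (yb (0, y, 0)).
  rewrite /= !(raddf0, raddfD, addr0, add0r) => E.
  by rewrite -{1}E addrK.
pose g u := u + c' (b' (a u) - d (b' (a u))).
have gK : cancel (one_sub a) g.
  move=> x; rewrite /g /one_sub /= raddfB -bac bK ca cK; exact: subrK.
have sK v : exists x, one_sub a x = v.
  exists (v + a (c' (b' v - d (b' v)))).
  rewrite /one_sub /= raddfD opprD addrACA -bac Kc !raddfB ab Kb.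
  exact: subrK.
by exists g => // u; have [x <-] := sK u; rewrite gK.
Qed.

Lemma endo_inv_cancel f : bijective f ->
  cancel f (endo_inv f) /\ cancel (endo_inv f) f.
Proof.
case=> g fK gK; have injf := can_inj fK; split=> x.
- by apply: pinvKV; rewrite ?in_setE // => ? ? _ _; apply: injf.
- by apply: pinvK; rewrite in_setE; exists (g x).
Qed.

End AffineSolutions.

(* Main.v *)
Require Import Defs.
From HB Require Import structures.
From mathcomp Require Import all_boot all_order all_algebra.
From mathcomp Require Import all_classical.

Set Implicit Arguments.
Unset Strict Implicit.
Unset Printing Implicit Defensive.

Import GRing.Theory.
Local Open Scope ring_scope.
Local Open Scope classical_set_scope.

(** Write S for the affine map, S* for its linear part, p = 1 - a and u for the
    solution of p u = z, and put k = t + c u.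

    Part (i).  Adding constants to a linear map changes both sides of the braid
    relation by constants, so S is braided as soon as the relation holds at the
    origin ([affine_solution_braid0]).  The three coordinates of that single
    equation are rewritten with the relations between a, b, c, d that express
    the braid relation of S* ([linear_yang_baxter]); they become b (a k) = 0,
    d k = 0 and, given a k = 0, b k - k = s u ([affine_braid_shiftE]).  Since
    s a = 0 ([s_endo_a]), s u = s z.

    Part (ii).  In the structure group x y = g_x(y) f_y(x).  If g_x(y) = x, then
    x cancels, and injectivity forces f_y(x) = y.  For S this applies to
    (x, y) = (u, 0), giving k = 0, and to (u + x, y) with b y = p x, giving
    s = 0.  Conversely, if s = 0 and k = 0, let M = p c^-1.  The affine
    bijections v |-> M v + x of X satisfy the defining relations of the
    structure group: this amounts to b = M (1 - d), which is s = 0, and to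
    M t = -z, which is k = 0.  So the structure group acts on X, and the image
    of 0 under the generator x recovers x.  Hence S is injective if and only if
    s = 0 and k = 0 ([affine_injectiveE]); the case z = t = 0 says that S* is
    injective if and only if s = 0, and comparing the two gives (ii). *)

(** * Detecting and using injectivity in the structure group *)

Section WordAction.
Variables (X : choiceType) (S : X * X -> X * X) (V : Type).
Variables (act inv : X -> V -> V).

Definition letter_act (l : bool * X) : V -> V :=
  if l.1 then inv l.2 else act l.2.

Definition word_act (w : seq (bool * X)) (v : V) : V := foldr letter_act v w.

(** A family of bijections satisfying the defining relations makes the structure
    group act on [V].  Working with words and an explicit inverse family avoids
    building the group of all bijections of [V]. *)
Lemma word_cong_act u v :
  (forall x, cancel (act x) (inv x)) -> (forall x, cancel (inv x) (act x)) ->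
  (forall x y, act x \o act y =1 act (S (x, y)).1 \o act (S (x, y)).2) ->
  word_cong S u v -> word_act u =1 word_act v.
Proof.
move=> actK invK actS.
elim=> {u v} [//|u v _ E p|u v w _ E1 _ E2 p|u v e x p|u v x y x1 y1 E p].
- by rewrite E.
- by rewrite E1.
- rewrite /word_act !foldr_cat /letter_act /=.
  by case: e; rewrite /= ?actK ?invK.
- rewrite /word_act !foldr_cat /letter_act /=.
  by have := actS x y (foldr letter_act p v); rewrite E /letter_act /= => ->.
Qed.

End WordAction.

(** The relation reads [x y = x (S (x, y)).2] in the structure group, where [x]
    can be cancelled. *)
Lemma injective_set_fixpoint (X : choiceType) (S : X * X -> X * X) (x y : X) :
  injective_set S -> (S (x, y)).1 = x -> (S (x, y)).2 = y.
Proof.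
move=> injS gxy; apply: injS.
apply: (@mulgI _ (structure_gen S x)); apply/esym/structure_genP.
by rewrite [LHS]surjective_pairing gxy.
Qed.

(** * Relations between the coefficients of a linear solution *)

Section Affine.
Variables (X : zmodType) (a b c d : {additive X -> X}).

Hypothesis linS : linear_solution (linear_map a b c d).

Lemma linear_solution_bij_b : bijective b.
Proof.
move: linS; rewrite linear_map_affine => -[[_ nd] _].
by have [] := affine_solution_bij nd.
Qed.

Lemma linear_solution_bij_c : bijective c.
Proof.
move: linS; rewrite linear_map_affine => -[[_ nd] _].
by have [] := affine_solution_bij nd.
Qed.

(** Four of the coefficient identities of the braid relation: each is one
    coordinate of that relation evaluated on a vector supported on one
    coordinate. *)
Lemma linear_yang_baxter :
  [/\ forall x, b (a (c x)) = a (one_sub a x),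
      forall x, c (one_sub a x) - d (a (c x)) = c x - a (c x),
      forall x, b (d x) = one_sub a (d (b x))
    & forall x, d (c x) = c (d (one_sub a x))].
Proof.
move: linS; rewrite linear_map_affine => -[[[_ _ yb] _] _]; split=> x.
- have := congr1 (fun p => p.1.1) (yb (x, 0, 0)).
  rewrite /= !(raddf0, raddfD, addr0) => E.
  by rewrite raddfN -{1}E addrAC subrr add0r.
- have := congr1 (fun p => p.1.2) (yb (x, 0, 0)).
  rewrite /= !(raddf0, raddfD, addr0) => E.
  by rewrite -[in RHS]E opprD addrA raddfN.
- have := congr1 (fun p => p.1.2) (yb (0, 0, x)).
  rewrite /= !(raddf0, raddfD, addr0, add0r) => E.
  by rewrite {1}E addrAC subrr add0r.
- have := congr1 (fun p => p.2) (yb (0, x, 0)).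
  rewrite /= !(raddf0, raddfD, addr0, add0r) => E.
  by rewrite !raddfN E addrAC subrr add0r.
Qed.

Lemma s_endoE x :
  s_endo a b c d x = b (c x) - (one_sub a x - one_sub a (d (one_sub a x))).
Proof. by congr (_ - _); rewrite /= opprB addrA addrAC. Qed.

(** Since [s] kills the image of [a], it takes the same value at [z] and at the
    preimage of [z] under [1 - a]. *)
Lemma s_endo_a x : s_endo a b c d (a x) = 0.
Proof.
have [bac caE bd _] := linear_yang_baxter.
have ca : c (a x) = a (c x) - d (a (c x)).
  apply/oppr_inj/(addrI (c x)); rewrite opprB.
  rewrite -[LHS](subrK (d (a (c x)))) -raddfB caE.
  by rewrite -addrA [- _ + _]addrC.
have pa y : one_sub a (a y) = a (one_sub a y) by rewrite /= raddfB.
by rewrite s_endoE ca raddfB bd bac pa subrr.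
Qed.

(** * When an affine map is a solution *)

Lemma affine_braid0 z t (S := affine_map a b c d z t) :
  S12 S (S23 S (S12 S 0)) = S23 S (S12 S (S23 S 0)) <->
  [/\ a z + b (a t) = 0, c (d z) + d t = 0
    & c z + d (a t + z) + t = a (d z + t) + b t + z].
Proof.
rewrite /S /S12 /S23 /= !(raddf0, addr0, add0r).
split=> [[E1 E2 E3]|[E1 E3 E2]]; last congr (_, _, _) => //.
- split=> //.
  + by apply: (addIr (b z)); apply: (addIr z); rewrite add0r -E1 raddfD addrA.
  + apply: (addrI (c t)); apply: (addIr t); rewrite addr0 [RHS]E3 raddfD.
    by rewrite addrA [c t + _]addrC.
- by rewrite raddfD addrA E1 add0r.
- by rewrite raddfD -[LHS]add0r -E3 !addrA [_ + d t + c t]addrAC.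
Qed.

(** Both sides of the braid relation are additive up to a constant, with
    additive parts equal by the relation of the linear part; only the constants,
    which are the values at the origin, remain to be compared. *)
Lemma affine_solution_braid0 z t (S := affine_map a b c d z t) :
  affine_solution S <-> S12 S (S23 S (S12 S 0)) = S23 S (S12 S (S23 S 0)).
Proof.
split=> [[[[_ _ yb] _] _]|yb0]; first exact: (yb 0).
have [[[_ bS yb] nd] _] := linS.
split; last by exists a, b, c, d, z, t.
have [b' bK Kb] := linear_solution_bij_b.
have [c' cK Kc] := linear_solution_bij_c.
split; [split; first by exists; exact: 0|split].
- have -> : S = (fun p => (p.1 + z, p.2 + t)) \o linear_map a b c d by [].
  apply: bij_comp bS; exists (fun p => (p.1 - z, p.2 - t)) => -[x y] /=;
    by rewrite ?subrK ?addrK.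
- move=> p; have := yb p; have := yb0.
  rewrite /= /S !(S12_affine, S23_affine, S12_linearD, S23_linearD).
  rewrite !(S12_linear0, S23_linear0, add0r) -!addrA.
  by move=> E ->; rewrite E.
- move=> x; exists (fun y => b' (y - z - a x)) => y; rewrite /gmap /=.
    by rewrite addrK addrAC subrr add0r bK.
  by rewrite Kb addrC !subrKC.
- move=> y; exists (fun x => c' (x - t - d y)) => x; rewrite /Defs.fmap /=.
    by rewrite !addrK cK.
  by rewrite Kc !subrK.
Qed.

(** The choice [t = - c u] cancels every term of the first two equations, so
    that [k] measures how far [t] is from it. *)
Lemma affine_braid_shiftE u z t k : one_sub a u = z -> t = - c u + k ->
  [/\ a z + b (a t) = 0, c (d z) + d t = 0
    & c z + d (a t + z) + t = a (d z + t) + b t + z] <->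
  [/\ a k = 0, d k = 0 & b k - k = s_endo a b c d z].
Proof.
move=> uz ->; have [bac caE bd dc] := linear_yang_baxter.
have -> : a z + b (a (- c u + k)) = b (a k).
  by rewrite !(raddfD, raddfN) bac uz addNKr.
have -> : c (d z) + d (- c u + k) = d k.
  by rewrite !(raddfD, raddfN) dc uz addNKr.
have su : s_endo a b c d z = b (c u) - (z - (d z - a (d z))).
  by rewrite -uz raddfB s_endo_a subr0 s_endoE.
have [b' bK _] := linear_solution_bij_b.
have E2 : a k = 0 ->
  (c z + d (a (- c u + k) + z) + (- c u + k)
     = a (d z + (- c u + k)) + b (- c u + k) + z)
  <-> b k - k = s_endo a b c d z.
  move=> ak; rewrite su !(raddfD a) !(raddfD d) (raddfD b) !(raddfN a).
  rewrite (raddfN d) (raddfN b) ak raddf0 !addr0.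
  have -> : c z + (- d (a (c u)) + d z) + (- c u + k) = - a (c u) + d z + k.
    rewrite [c z + _]addrA; have := caE u; rewrite uz => ->.
    by rewrite -[X in X + (_ + k)]addrA addrACA subrr add0r.
  (* The defects of the two equations are equal, by an identity valid in any
     abelian group. *)
  have eq_sub (A B D E K L : X) :
      E - A + (- B + L) + z - (- A + D + K) = L - K - (B - (z - (D - E))).
    rewrite !opprD !opprK [LHS](AC (2*2*1*3) ((2*6)*((4*8)*(3*(5*(7*1)))))).
    by rewrite /= addNr add0r.
  have {eq_sub} := eq_sub (a (c u)) (b (c u)) (d z) (a (d z)) k (b k).
  move=> eq_sub; split=> E; apply/eqP.
    by rewrite -subr_eq0 -eq_sub E subrr.
  by rewrite eq_sym -subr_eq0 eq_sub E subrr.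
split=> -[H1 H2 H3].
- have ak : a k = 0 by rewrite -(bK (a k)) H1 -[RHS]bK raddf0.
  by split=> //; apply/(E2 _).
- by rewrite H1 H2 raddf0; split=> //; apply/(E2 _).
Qed.

(** * Injectivity *)

(** Necessity evaluates [injective_set_fixpoint] at pairs whose image has the
    same first coordinate; sufficiency comes from an action of the structure
    group on [X] by affine bijections. *)
Lemma affine_injectiveE u z t k : one_sub a u = z -> t = - c u + k ->
  injective_set (affine_map a b c d z t) <->
  (forall x, s_endo a b c d x = 0) /\ k = 0.
Proof.
move=> uz tE; have [_ _ bd dc] := linear_yang_baxter.
have [b' bK Kb] := linear_solution_bij_b.
have [c' cK Kc] := linear_solution_bij_c.
split=> [injS|[s0 k0]].
  have fixS x y : a x + b y + z = x -> c x + d y + t = y.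
    exact: (@injective_set_fixpoint _ (affine_map a b c d z t)).
  have k0 : k = 0.
    have := fixS u 0; rewrite !raddf0 !addr0 tE addNKr => -> //.
    by rewrite -uz /= subrKC.
  split=> // x; set y := b' (one_sub a x).
  have cdy : c x = y - d y.
    have := fixS (u + x) y; rewrite (raddfD a) (raddfD c) Kb tE k0 addr0.
    rewrite -uz /= -[a u + _ + _]addrA subrKC addrAC subrKC => /(_ erefl).
    rewrite -[c u + _ + _]addrA addrAC subrr add0r => E.
    by rewrite -[X in X - _]E addrK.
  by rewrite s_endoE cdy raddfB bd Kb subrr.
(* [M] is [(1 - a) c^-1]; its two properties below are kept abstract so that
   simplification does not unfold it. *)
have [M MD Mc] : exists2 M : X -> X, {morph M : x y / x + y}
    & forall x, M (c x) = one_sub a x.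
  exists (fun x => one_sub a (c' x)) => [x y|x]; last by rewrite cK.
  by rewrite -(raddfD (one_sub a)); congr (one_sub a _);
    apply: (can_inj cK); rewrite (raddfD c) !Kc.
have [p' pK Kp] := linear_solution_one_sub linS.
(* This is where [s = 0] enters. *)
have bE y : b y = M y - M (d y).
  rewrite -[y]Kc Mc dc Mc; apply/eqP; rewrite -subr_eq0.
  by rewrite -s_endoE s0.
pose act x v := M v + x; pose inv x v := c (p' (v - x)).
move=> x y /word_classP.
move/(@word_cong_act _ _ _ act inv)=> /(_ _ _ _ 0) E.
(* The letter [x] sends 0 to [M 0 + x]. *)
apply: (addrI (M 0)); apply: E => {x y}[x v|x v|x y v].
- by rewrite /inv /act addrK -[v]Kc Mc pK.
- by rewrite /inv /act Mc Kp subrK.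
- change (M (M v + y) + x = M (M v + (c x + d y + t)) + (a x + b y + z)).
  have -> : t = c (- u) by rewrite raddfN tE k0 addr0.
  rewrite !MD !Mc raddfN uz bE -!addrA; congr (_ + _).
  move=> /=; move: (M y) (M (d y)) (a x) => P Q R.
  rewrite [RHS](AC (1*(1*(1*(1*(1*(1*2)))))) ((6*1)*((2*5)*((3*7)*(4*8))))).
  by rewrite /= addNr subrr addNr !addr0.
Qed.

Lemma affine_solution_parameterE z t :
  affine_solution (affine_map a b c d z t) <->
  exists k, affine_parameter a b c d z t k.
Proof.
have [_ /(_ z) uz] := endo_inv_cancel (linear_solution_one_sub linS).
split=> [/affine_solution_braid0/affine_braid0 E|[k [tE ak dk bk]]].
  exists (t + c (endo_inv (one_sub a) z)).
  have tE : t = - c (endo_inv (one_sub a) z) + (t + c (endo_inv (one_sub a) z)).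
    by rewrite addrC addrK.
  by have [] := (affine_braid_shiftE uz tE).1 E.
apply/affine_solution_braid0/affine_braid0.
exact: (affine_braid_shiftE uz tE).2.
Qed.

(** [s] depends only on the linear part, so [affine_injectiveE] applies to the
    affine map and to its linear part with the same [s]. *)
Lemma affine_parameter_injectiveE z t k : affine_parameter a b c d z t k ->
  injective_set (affine_map a b c d z t) <->
  injective_set (linear_map a b c d) /\ k = 0.
Proof.
have [_ /(_ z) uz] := endo_inv_cancel (linear_solution_one_sub linS).
case=> tE _ _ _; have := affine_injectiveE uz tE.
have := @affine_injectiveE 0 0 0 0; rewrite -linear_map_affine !raddf0 addr0.
by move=> /(_ erefl erefl) -> ->; split=> [[]|[[]]].
Qed.

End Affine.

(** * The characterization of affine solutions *)

Theorem theorem3p3 (X : zmodType) :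
  (* (i) *)
  (forall a b c d : {additive X -> X},
    linear_solution (linear_map a b c d) ->
    forall z t : X,
      associated (affine_map a b c d z t) (linear_map a b c d) <->
      exists k : X, affine_parameter a b c d z t k)
  /\
  (* (ii) *)
  (forall (a b c d : {additive X -> X}) (z t k : X),
    affine_solution (affine_map a b c d z t) ->
    affine_parameter a b c d z t k ->
    (injective_set (affine_map a b c d z t) <->
     injective_set (linear_map a b c d) /\ k = 0))
  /\
  (forall a b c d : {additive X -> X},
    linear_solution (linear_map a b c d) ->
    injective_set (linear_map a b c d) ->
    set_bij [set: X]
      [set S : X * X -> X * X |
        associated S (linear_map a b c d) /\ injective_set S]
      (fun z => affine_map a b c d z (- c (endo_inv (one_sub a) z)))).
Proof.
split; [|split] => [a b c d linS z t|a b c d z t k affS par|a b c d linS injL].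
- apply: iff_trans (affine_solution_parameterE linS z t).
  by split=> [[]|] // affS; split=> //; exists a, b, c, d, z, t.
- have linS := affine_solution_linear affS.
  exact: (affine_parameter_injectiveE linS par).
have par z : affine_parameter a b c d z (- c (endo_inv (one_sub a) z)) 0.
  have [s0 _] : (forall x, s_endo a b c d x = 0) /\ (0 : X) = 0.
    apply/(@affine_injectiveE X a b c d linS 0 0 0 0).
    + exact: raddf0.
    + by rewrite !raddf0 addr0.
    + by rewrite -linear_map_affine.
  by split; rewrite ?raddf0 ?addr0 ?subr0 // s0.
split.
- move=> z _; split; last exact/(affine_parameter_injectiveE linS (par z)).
  split; last by exists a, b, c, d, z, (- c (endo_inv (one_sub a) z)).
  by apply/(affine_solution_parameterE linS); exists 0.
- move=> z1 z2 _ _ /(congr1 (fun S : X * X -> X * X => (S (0, 0)).1)).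
  by rewrite /= !raddf0 !add0r.
- move=> S [[affS [a' [b' [c' [d' [z [t [SE LE]]]]]]]] injS].
  (* The decomposition of [S] may use other letters for the same maps. *)
  have {}SE : S = affine_map a b c d z t.
    rewrite SE; apply/funext => p.
    have := congr1 (fun L => L p) LE => -[E1 E2].
    by rewrite /affine_map E1 E2.
  rewrite {}SE in affS injS *; exists z => //.
  have /(affine_solution_parameterE linS)[k pk] := affS.
  have [_ k0] := (affine_parameter_injectiveE linS pk).1 injS.
  by case: pk => -> _ _ _; rewrite k0 addr0.
Qed.
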